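(* Let $n\ge2$, $N=n(n-1)/2$, and let $g$ be a probability density on $(0,\infty)$ with $\tilde G(s)=\int_0^\infty e^{-st}g(t)\,dt$. For parameters $(q,s)$ with $q\in(0,1]$, $s\ge0$, suppose that the number of edges $e$ is binomial with $N$ trials and success probability $q\,\tilde G(s)$ and that, conditionally on $e$, the edge lengths $d_1,\dots,d_e$ are independent with density $f(d\mid s)=g(d)e^{-sd}/\tilde G(s)$. Given an observation with $e\ge1$ and $g(d_i)>0$ for all $i$, let $\hat s$ be the maximum likelihood estimate of $s$, i.e. the maximiser over $s\ge0$ of $\prod_{i=1}^e f(d_i\mid s)$ (assumed to exist). Then, by the functional invariance of maximum likelihood estimates, $$\hat q=\frac{2e}{n(n-1)\,\tilde G(\hat s)}$$ is the maximum likelihood estimate of $q$.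
   Context: This is the independent-links model of a Waxman random graph: $n$ nodes are placed independently and uniformly at random in a region, and each pair at distance $d$ is linked independently with probability $q e^{-sd}$; $g$ is the density of the distance between two independent uniformly random points of the region. Independence of the edge lengths is assumed as an approximation. Functional invariance of maximum likelihood estimates means: if parameters are related through a transformation $a=\phi(s)$, then the maximum likelihood estimate of $a$ is $\hat a=\phi(\hat s)$.
   Formalization: The estimate q̂ can exceed 1, so it is shown to be the MLE (jointly with ŝ, uniquely) over all q>0, s≥0 with q·G̃(s)≤1, and over the stated range q∈(0,1], s≥0 only under the added hypothesis q̂≤1. *)

(* Defs.v *)
From HB Require Import structures.
From mathcomp Require Import all_boot all_order all_algebra.
From mathcomp Require Import all_classical all_reals all_analysis.

Set Implicit Arguments.
Unset Strict Implicit.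
Unset Printing Implicit Defensive.

Import Order.TTheory GRing.Theory Num.Theory.
Import numFieldNormedType.Exports.

Local Open Scope classical_set_scope.
Local Open Scope ring_scope.

(* Only the values of [g] on ]0, +oo[ matter. *)
Definition pos_density (R : realType) (g : R -> R) : Prop :=
  [/\ measurable_fun (`]0, +oo[ : set R) g,
      (forall t, 0 < t -> 0 <= g t) &
      (\int[lebesgue_measure]_(t in (`]0%R, +oo[ : set R)) (g t)%:E = 1)%E].

Definition laplace (R : realType) (g : R -> R) (s : R) : R :=
  \int[lebesgue_measure]_(t in (`]0, +oo[ : set R)) (expR (- (s * t)) * g t).

Definition length_density (R : realType) (g : R -> R) (s d : R) : R :=
  g d * expR (- (s * d)) / laplace g s.

Definition length_likelihood (R : realType) (g : R -> R) (e : nat)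
    (d : 'I_e -> R) (s : R) : R :=
  \prod_(i < e) length_density g s (d i).

Definition num_pairs (n : nat) : nat := ((n * n.-1) %/ 2)%N.

(* Density of the whole observation (e, d_1, ..., d_e), as a function of the
   parameter [th] = (q, s): probability of e, times the conditional density of
   the lengths given e. *)
Definition waxman_likelihood (R : realType) (g : R -> R) (n e : nat)
    (d : 'I_e -> R) (th : R * R) : R :=
  binomial_pmf (num_pairs n) (th.1 * laplace g th.2) e
  * length_likelihood g d th.2.

Definition waxman_params (R : realType) : set (R * R) :=
  [set th | 0 < th.1 <= 1 /\ 0 <= th.2].

(* All the (q, s) for which q * laplace g s is a nonzero probability, i.e. the
   image of the pairs (p, s) in ]0, 1] * [0, +oo[ under the reparametrisation
   q = p / laplace g s.  It contains [waxman_params] since laplace g s <= 1. *)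
Definition binomial_params (R : realType) (g : R -> R) : set (R * R) :=
  [set th | [/\ 0 < th.1, 0 <= th.2 & th.1 * laplace g th.2 <= 1]].

Definition is_MLE (R : realType) (T : Type) (L : T -> R) (Theta : set T)
    (th : T) : Prop :=
  Theta th /\ forall th', Theta th' -> L th' <= L th.

Definition is_unique_MLE (R : realType) (T : Type) (L : T -> R)
    (Theta : set T) (th : T) : Prop :=
  is_MLE L Theta th /\ forall th', is_MLE L Theta th' -> th' = th.

(* Main.v *)
Require Import Defs.
From HB Require Import structures.
From mathcomp Require Import all_boot all_order all_algebra.
From mathcomp Require Import all_classical all_reals all_analysis.
From mathcomp Require Import measurable_realfun ring.

Set Implicit Arguments.
Unset Strict Implicit.
Unset Printing Implicit Defensive.

Import Order.TTheory GRing.Theory Num.Theory.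
Import numFieldNormedType.Exports.

Local Open Scope classical_set_scope.
Local Open Scope ring_scope.

(** With p = q * laplace g s the likelihood splits into a binomial factor that
    depends on p only and a length factor that depends on s only, and (p, s)
    determines (q, s) because the Laplace transform is positive.  This is the
    functional invariance at work: the joint maximiser is p = e / N together
    with s = shat, read back as q = (e / N) / laplace g shat.

    Uniqueness needs each factor to have a single maximiser.
    - The binomial factor p ^ e (1 - p) ^ (N - e) is strictly maximal at
      p = e / N (binomial_pmf_lt_mode).  This is the convexity bound
      1 + x <= expR x, strict off 0, applied to the two ratios p / phat and
      (1 - p) / (1 - phat): the tangent terms cancel exactly at e / N.
    - The length factor is strictly log-concave in s, since the Laplace
      transform of a density is strictly log-convex
      (laplace_midpoint_lt).  Two distinct maximisers would therefore be beaten
      by their midpoint (length_MLE_unique).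

    The original parameter set is a subset of binomial_params, because the
    Laplace transform is at most 1 there; a maximiser over the larger set that
    happens to satisfy q <= 1 is thus also the maximiser over the smaller one
    (is_unique_MLE_subset). *)

(** Every maximiser over [B] reaches the value at [th], which is already the
    maximum over [A], so it is a maximiser over [A] as well. *)
Lemma is_unique_MLE_subset (R : realType) (T : Type) (L : T -> R)
    (A B : set T) (th : T) :
  B `<=` A -> B th -> is_unique_MLE L A th -> is_unique_MLE L B th.
Proof.
move=> BA Bth [[Ath maxth] uniqth]; split.
  by split=> // th' /BA/maxth.
move=> th' [Bth' maxth']; apply: uniqth; split; first exact: BA.
by move=> th'' /maxth/le_trans; apply; exact: maxth'.
Qed.

(** * The binomial factor *)

(** Write r for e / (e + k).  Bounding p / r and (1 - p) / (1 - r) by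
    expR (x - 1) and raising them to the powers e and k yields an exponent equal
    to 0, because r is the critical point of the logarithm of the product. *)
Lemma bernoulli_product_lt (R : realType) (e k : nat) (p : R) :
  (0 < e)%N -> 0 <= p <= 1 -> p != e%:R / (e + k)%:R ->
  p ^+ e * (1 - p) ^+ k <
  (e%:R / (e + k)%:R) ^+ e * (1 - e%:R / (e + k)%:R) ^+ k.
Proof.
move=> e0 /andP[p0 p1]; set r : R := e%:R / _ => pr.
have eR0 : (0 : R) < e%:R by rewrite ltr0n.
have r0 : 0 < r by rewrite divr_gt0// ltr0n addn_gt0 e0.
have x1 : p / r - 1 != 0.
  rewrite subr_eq0; apply: contraNneq pr => xr.
  by rewrite -[p](divfK (lt0r_neq0 r0)) xr mul1r.
have xlt : (p / r) ^+ e < expR (e%:R * (p / r - 1)).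
  have lt := expR_gt1Dx x1; rewrite addrC subrK in lt.
  by rewrite expRM_natl ltrXn2r ?divr_ge0 ?(ltW r0)// -lt0n.
(* For k = 0 the mode is r = 1 and the ratio (1 - p) / (1 - r) is meaningless. *)
have [k0|k0] := posnP k.
  rewrite k0 !expr0 !mulr1 ltrXn2r// -?lt0n//; move: pr.
  by rewrite /r k0 addn0 divff ?lt0r_neq0// => pr; rewrite lt_neqAle pr.
have kR : (0 : R) < k%:R by rewrite ltr0n.
have r1 : 0 < 1 - r.
  rewrite subr_gt0 ltr_pdivrMr ?mul1r ?ltr_nat ?ltr0n ?addn_gt0 ?e0//.
  by rewrite -[ltnLHS]addn0 ltn_add2l.
have yle :
    ((1 - p) / (1 - r)) ^+ k <= expR (k%:R * ((1 - p) / (1 - r) - 1)).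
  have le := expR_ge1Dx ((1 - p) / (1 - r) - 1); rewrite addrC subrK in le.
  have y0 : 0 <= (1 - p) / (1 - r) by rewrite divr_ge0 ?(ltW r1)// subr_ge0.
  by rewrite expRM_natl lerXn2r// nnegrE expR_ge0.
have tangent : e%:R * (p / r - 1) + k%:R * ((1 - p) / (1 - r) - 1) = 0.
  rewrite /r natrD; field.
  by rewrite [_ + _ - _]addrC addKr !lt0r_neq0 ?addr_gt0.
have ratio : (p / r) ^+ e * ((1 - p) / (1 - r)) ^+ k < 1.
  rewrite -[ltRHS]expR0 -tangent expRD.
  apply: (@le_lt_trans _ _
      ((p / r) ^+ e * expR (k%:R * ((1 - p) / (1 - r) - 1)))).
    by rewrite ler_wpM2l// exprn_ge0// divr_ge0// ltW.
  by rewrite ltr_pM2r ?expR_gt0.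
(* [r] is made opaque so that expr_div_n does not split it as a quotient. *)
clearbody r; move: ratio; rewrite !expr_div_n mulf_div ltr_pdivrMr ?mul1r//.
by rewrite mulr_gt0 ?exprn_gt0.
Qed.

Lemma binomial_pmf_lt_mode (R : realType) (N e : nat) (p : R) :
  (0 < e <= N)%N -> 0 <= p <= 1 -> p != e%:R / N%:R ->
  binomial_pmf N p e < binomial_pmf N (e%:R / N%:R) e.
Proof.
move=> /andP[e0 eN] p01 pr; rewrite /binomial_pmf ltr_pMn2r ?bin_gt0//.
by have := @bernoulli_product_lt R e (N - e) p; rewrite subnKC//; apply.
Qed.

Lemma natr_num_pairs (R : realType) (n : nat) : (0 < n)%N ->
  (num_pairs n)%:R * 2 = n%:R * (n%:R - 1) :> R.
Proof.
case: n => // n _; rewrite -natrM divnK; first by rewrite natrM -natr1 addrK.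
by rewrite dvdn2 oddM /= andNb.
Qed.

(** * Laplace transform of a density on the half-line *)

Section length_model.
Context {R : realType} (g : R -> R).
Hypothesis gd : pos_density g.
Local Notation mu := (@lebesgue_measure R).
Local Notation D := (`]0, +oo[%classic : set R).

Let mg : measurable_fun D g. Proof. by case: gd. Qed.
Let g_ge0 t : D t -> 0 <= g t.
Proof. by rewrite /= in_itv /= andbT; case: gd => _ + _; apply. Qed.
Let g_int1 : (\int[mu]_(t in D) (g t)%:E = 1)%E. Proof. by case: gd. Qed.

Lemma pos_density_integrable : mu.-integrable D (EFin \o g).
Proof.
apply/integrableP; split; first exact/measurable_EFinP.
under eq_integral => t /set_mem Dt do rewrite /= ger0_norm ?g_ge0//.
by rewrite g_int1 ltry.
Qed.

Lemma measurable_expR_scale (s : R) :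
  measurable_fun D (fun t => expR (- (s * t))).
Proof.
apply/measurable_funTS/measurableT_comp => //.
by apply: measurableT_comp => //; exact: measurable_funM.
Qed.

Lemma laplace_integrable (s : R) : 0 <= s ->
  mu.-integrable D (EFin \o (fun t => expR (- (s * t)) * g t)).
Proof.
move=> s0; apply: (le_integrable _ _ _ pos_density_integrable) => //.
  by apply/measurable_EFinP/measurable_funM => //; exact: measurable_expR_scale.
move=> t Dt /=; rewrite lee_fin normrM ler_piMl// ger0_norm ?expR_ge0//.
rewrite expR_le1 oppr_le0 mulr_ge0//.
by move: Dt; rewrite /= in_itv /= andbT => /ltW.
Qed.

Lemma laplace_le1 (s : R) : 0 <= s -> laplace g s <= 1.
Proof.
move=> s0; rewrite -[leRHS](_ : \int[mu]_(t in D) g t = 1); last first.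
  by rewrite /Rintegral g_int1.
apply: le_Rintegral => //; first exact: laplace_integrable.
  exact: pos_density_integrable.
move=> t Dt; rewrite ler_piMl ?g_ge0// expR_le1 oppr_le0 mulr_ge0//.
by move: Dt; rewrite /= in_itv /= andbT => /ltW.
Qed.

(** The common source of all strict inequalities on the Laplace transform.  If
    the integral vanished, h g would be 0 almost everywhere; [h] has at most one
    zero and points are Lebesgue-null, so g itself would be 0 almost
    everywhere, against its total mass 1. *)
Lemma weighted_integral_gt0 (h : R -> R) (t0 : R) :
  mu.-integrable D (EFin \o (fun t => h t * g t)) ->
  (forall t, t != t0 -> 0 < h t) ->
  (forall t, 0 <= h t) ->
  0 < \int[mu]_(t in D) (h t * g t).
Proof.
move=> ih hgt0 hge0.
have hg0 t : D t -> 0 <= h t * g t by move=> Dt; rewrite mulr_ge0 ?g_ge0.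
rewrite lt_neqAle Rintegral_ge0// andbT eq_sym; apply/eqP => int0.
have mD : measurable D by [].
have mhg := measurable_int _ ih.
have : (\int[mu]_(t in D) `|(EFin \o (fun t => h t * g t)%R) t| = 0)%E.
  under eq_integral => t /set_mem Dt do rewrite /= ger0_norm ?hg0//.
  rewrite -[LHS]fineK ?integrable_fin_num//.
  by move: int0; rewrite /Rintegral => ->.
move=> /(ae_eq_integral_abs mu mD mhg) hgae.
have nt0 : {ae mu, forall t : R, t != t0}.
  exists [set t0]; split => //; first exact: lebesgue_measure_set1.
  by move=> t /= /negP; rewrite negbK => /eqP.
have gae : ae_eq mu D (EFin \o g) (cst 0%E).
  apply: filterS2 hgae nt0 => t + tt0 Dt => /(_ Dt) /= [] /eqP.
  by rewrite mulf_eq0 gt_eqF ?hgt0//= => /eqP ->.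
have : (\int[mu]_(t in D) (g t)%:E = \int[mu]_(t in D) 0)%E.
  by apply: ae_eq_integral gae => //; exact/measurable_EFinP.
by rewrite integral0 g_int1 => /eqP; rewrite eqe oner_eq0.
Qed.

Lemma laplace_gt0 (s : R) : 0 <= s -> 0 < laplace g s.
Proof.
move=> s0; apply: (@weighted_integral_gt0 _ 0) => *.
- exact: laplace_integrable.
- exact: expR_gt0.
- exact: expR_ge0.
Qed.

(** Strict log-convexity, as a strict Cauchy-Schwarz inequality between
    expR (- (s1 * t) / 2) and expR (- (s2 * t) / 2) for the density g: integrate
    the square of [root] below against g.  That square vanishes at a single
    point, since the ratio of the two exponentials is strictly monotone. *)
Lemma laplace_midpoint_lt (s1 s2 : R) : 0 <= s1 -> 0 <= s2 -> s1 != s2 ->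
  laplace g ((s1 + s2) / 2) ^+ 2 < laplace g s1 * laplace g s2.
Proof.
move=> s10 s20 s12; set m := (s1 + s2) / 2.
have m0 : 0 <= m by rewrite divr_ge0 ?addr_ge0.
have L20 := laplace_gt0 s20; have Lm0 := laplace_gt0 m0.
(* [c] is the orthogonal projection coefficient, which minimises the integral. *)
set c := laplace g m / laplace g s2.
have c0 : 0 < c by rewrite divr_gt0.
pose root t := expR (- (s1 * t) / 2) - c * expR (- (s2 * t) / 2).
have sq t : root t ^+ 2 =
    expR (- (s1 * t)) - (2 * c) * expR (- (m * t)) + c ^+ 2 * expR (- (s2 * t)).
  rewrite [- (s1 * t) in RHS](_ : _ = - (s1 * t) / 2 + - (s1 * t) / 2);
    last by field.
  rewrite [- (s2 * t) in RHS](_ : _ = - (s2 * t) / 2 + - (s2 * t) / 2);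
    last by field.
  rewrite [- (m * t)](_ : _ = - (s1 * t) / 2 + - (s2 * t) / 2);
    last by rewrite /m; field.
  by rewrite !expRD /root; ring.
pose t0 := 2 * ln c / (s2 - s1).
have root_neq0 t : t != t0 -> root t != 0.
  apply: contraNneq => /eqP; rewrite subr_eq0 => /eqP rt.
  have : ln (expR (- (s1 * t) / 2)) = ln (c * expR (- (s2 * t) / 2)).
    by rewrite rt.
  rewrite lnM ?posrE ?expR_gt0// !expRK => lt.
  apply/eqP; rewrite /t0 (_ : ln c = (s2 - s1) * t / 2).
    by field; rewrite subr_eq0 eq_sym.
  rewrite [LHS](_ : _ = - (s1 * t) / 2 + s2 * t / 2); first by field.
  by rewrite lt; field.
have i1 := laplace_integrable s10.
have i2 := laplace_integrable s20.
have im := laplace_integrable m0.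
have split_integrand t : root t ^+ 2 * g t =
    expR (- (s1 * t)) * g t - (2 * c) * (expR (- (m * t)) * g t)
    + c ^+ 2 * (expR (- (s2 * t)) * g t).
  by rewrite sq; ring.
have iZ (r s : R) : 0 <= s ->
      mu.-integrable D (EFin \o (fun t : R => r * (expR (- (s * t)) * g t))).
  by move=> s0; apply: eq_integrable (integrableZl _ r (laplace_integrable s0)).
have iB : mu.-integrable D
    (EFin \o (fun t =>
       expR (- (s1 * t)) * g t - (2 * c) * (expR (- (m * t)) * g t))).
  by by apply: eq_integrable (integrableB _ i1 (iZ (2 * c) _ m0)).
have iS : mu.-integrable D (EFin \o (fun t => root t ^+ 2 * g t)).
  under [X in _ \o X]funext => t do rewrite split_integrand.
  by apply: eq_integrable (integrableD _ iB (iZ (c ^+ 2) _ s20)).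
have : 0 < \int[mu]_(t in D) (root t ^+ 2 * g t).
  apply: (@weighted_integral_gt0 (fun t => root t ^+ 2) t0) => // t.
    by move=> /root_neq0 rt; rewrite exprn_even_gt0.
  by rewrite sqr_ge0.
under eq_Rintegral do rewrite split_integrand.
rewrite RintegralD// ?RintegralB//; try exact: iZ.
rewrite !RintegralZl//.
rewrite -!/(laplace g _) [X in 0 < X -> _](_ : _ =
    (laplace g s1 * laplace g s2 - laplace g m ^+ 2) / laplace g s2).
  by rewrite pmulr_lgt0 ?invr_gt0// subr_gt0.
by rewrite /c; field; rewrite gt_eqF.
Qed.

(** * The length factor *)

Lemma length_density_gt0 (s t : R) :
  0 <= s -> 0 < g t -> 0 < length_density g s t.
Proof. by move=> s0 gt; rewrite divr_gt0 ?laplace_gt0// mulr_gt0 ?expR_gt0. Qed.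

(** The factor g t expR (- (s * t)) is log-affine in s, so only the normalising
    constant matters, and its reciprocal is strictly log-concave. *)
Lemma length_density_midpoint_gt (s1 s2 t : R) :
  0 <= s1 -> 0 <= s2 -> s1 != s2 -> 0 < g t ->
  length_density g s1 t * length_density g s2 t <
  length_density g ((s1 + s2) / 2) t ^+ 2.
Proof.
move=> s10 s20 s12 gt; have := laplace_midpoint_lt s10 s20 s12.
rewrite /length_density; set m := (s1 + s2) / 2 => lt.
have Lm : 0 < laplace g m by rewrite laplace_gt0// divr_ge0 ?addr_ge0.
rewrite mulf_div mulrACA -expRD.
rewrite [X in expR X](_ : _ = - (m * t) + - (m * t)); last by rewrite /m; field.
rewrite expr_div_n expRD mulrACA -expr2 ltr_pM2l ?exprn_gt0 ?mulr_gt0 ?expR_gt0//.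
by rewrite ltf_pV2// posrE ?exprn_gt0// mulr_gt0 ?laplace_gt0.
Qed.

Section sample.
Variables (e : nat) (d : 'I_e -> R).
Hypothesis gd_gt0 : forall i, 0 < g (d i).

Lemma length_likelihood_gt0 (s : R) : 0 <= s -> 0 < length_likelihood g d s.
Proof. by move=> s0; apply: prodr_gt0 => i _; exact: length_density_gt0. Qed.

(** At the midpoint of two distinct maximisers the squared likelihood would
    exceed the product of the two maximal values. *)
Lemma length_MLE_unique (s1 s2 : R) : (0 < e)%N ->
  is_MLE (length_likelihood g d) [set s | 0 <= s] s1 ->
  is_MLE (length_likelihood g d) [set s | 0 <= s] s2 -> s1 = s2.
Proof.
move=> e0 [/= s10 max1] [/= s20 max2]; apply/eqP/negPn/negP => s12.
have m0 : 0 <= (s1 + s2) / 2 by rewrite divr_ge0 ?addr_ge0.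
suff : length_likelihood g d s1 * length_likelihood g d s2 <
       length_likelihood g d ((s1 + s2) / 2) ^+ 2.
  rewrite ltNge expr2 ler_pM ?max1 ?max2//; exact/ltW/length_likelihood_gt0.
rewrite /length_likelihood -big_split -prodrXl /=; apply: ltr_prod.
  by apply/hasP; exists (Ordinal e0); rewrite ?mem_index_enum.
move=> i _; rewrite length_density_midpoint_gt// andbT.
by rewrite mulr_ge0// ltW// length_density_gt0.
Qed.

End sample.
End length_model.

(** * The joint estimate *)

Theorem mainTheorem7 (R : realType) (g : R -> R) (n e : nat) (d : 'I_e -> R)
    (shat : R) :
  (2 <= n)%N ->
  pos_density g ->
  (1 <= e <= num_pairs n)%N ->
  (forall i, 0 < d i /\ 0 < g (d i)) ->
  is_MLE (length_likelihood g d) [set s | 0 <= s] shat ->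
  let qhat := 2 * e%:R / (n%:R * (n%:R - 1) * laplace g shat) in
  is_unique_MLE (waxman_likelihood g n d) (binomial_params g) (qhat, shat) /\
  (qhat <= 1 ->
   is_unique_MLE (waxman_likelihood g n d) (@waxman_params R) (qhat, shat)).
Proof.
move=> n2 gd eN dpos shatP qhat.
have [/= shat0 maxshat] := shatP.
have gpos i : 0 < g (d i) by case: (dpos i).
have /andP[e0 eleN] := eN.
have N0 : (0 : R) < (num_pairs n)%:R by rewrite ltr0n (leq_trans e0).
have Lhat0 := laplace_gt0 gd shat0.
have lhat0 := length_likelihood_gt0 gd gpos shat0.
set phat : R := e%:R / (num_pairs n)%:R.
have phat0 : 0 < phat by rewrite divr_gt0// ltr0n.
have phat1 : phat <= 1 by rewrite ler_pdivrMr// mul1r ler_nat.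
have qhatE : qhat = phat / laplace g shat.
  rewrite /qhat -natr_num_pairs 1?ltnW// /phat; field.
  by rewrite !gt_eqF.
have qhat0 : 0 < qhat by rewrite qhatE divr_gt0.
have qhatL : qhat * laplace g shat = phat by rewrite qhatE divfK// gt_eqF.
have Ble p : 0 <= p <= 1 ->
    binomial_pmf (num_pairs n) p e <= binomial_pmf (num_pairs n) phat e.
  by move=> p01; have [->//|/(binomial_pmf_lt_mode eN p01)/ltW] := eqVneq p phat.
(* The strict bound at p = 0 shows that the maximal binomial value is not 0. *)
have Bhat_gt0 : 0 < binomial_pmf (num_pairs n) phat e.
  have := @binomial_pmf_lt_mode R _ _ 0 eN; rewrite lexx ler01 eq_sym gt_eqF//.
  move=> /(_ isT isT); apply: le_lt_trans.
  by rewrite binomial_pmf_ge0// lexx ler01.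
have uniqhat :
    is_unique_MLE (waxman_likelihood g n d) (binomial_params g) (qhat, shat).
  have prob01 q s : binomial_params g (q, s) -> 0 <= q * laplace g s <= 1.
    by case=> /= q0 s0 ->; rewrite mulr_ge0// ltW// laplace_gt0.
  have hat_in : binomial_params g (qhat, shat) by split; rewrite //= qhatL.
  split.
    split=> // -[q s] qs; have [/= q0 s0 _] := qs.
    rewrite /waxman_likelihood /= qhatL ler_pM ?Ble ?maxshat ?prob01//.
      by rewrite binomial_pmf_ge0 ?prob01.
    exact/ltW/length_likelihood_gt0.
  move=> [q s] [qs maxqs]; have [/= q0 s0 _] := qs.
  have := maxqs _ hat_in; rewrite /waxman_likelihood /= qhatL => hat_le.
  (* A suboptimal p lowers the product strictly, whatever s is; with the optimal
     p, the length factor at s must already be maximal. *)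
  have qsL : q * laplace g s = phat.
    apply/eqP/negPn/negP => /(binomial_pmf_lt_mode eN (prob01 _ _ qs)) Blt.
    move: hat_le; rewrite leNgt => /negP; apply.
    apply: (@le_lt_trans _ _ (binomial_pmf (num_pairs n) (q * laplace g s) e
        * length_likelihood g d shat)).
      by rewrite ler_wpM2l ?maxshat// binomial_pmf_ge0 ?prob01.
    by rewrite ltr_pM2r.
  have sE : s = shat.
    apply: (length_MLE_unique gd gpos e0) shatP; split=> // s' s'0.
    apply: le_trans (maxshat _ s'0) _.
    by move: hat_le; rewrite qsL ler_pM2l.
  by rewrite qhatE -qsL sE mulfK// gt_eqF.
split=> // qhat1; apply: is_unique_MLE_subset uniqhat => //.
  move=> [q s] [/= /andP[q0 q1] s0]; split=> //=.
  by rewrite mulr_ile1 ?laplace_le1// ltW// laplace_gt0.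
by split; rewrite //= qhat0.
Qed.
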